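(* Let $X$ be a bounded commutative BCK-algebra, and let $\Im$ and $\Im'$ be the Baig topologies on $X$-modules $M$ and $M'$ admitted by decreasing sequences of submodules $(M_n)_{n\in\mathbb{Z}^+}$ of $M$ and $(M'_n)_{n\in\mathbb{Z}^+}$ of $M'$ respectively. Then every strict $X$-homomorphism $f:M\to M'$ is an open mapping.
   Context: A BCK-algebra is a set $X$ with a binary operation $*$ and a constant $0$ such that for all $a,b,c\in X$: $((a*b)*(a*c))*(c*b)=0$; $(a*(a*b))*b=0$; $a*a=0$; $0*a=0$; and $a*b=0=b*a$ implies $a=b$. Write $a\le b$ iff $a*b=0$ (a partial order), and $a\wedge b=b*(b*a)$. $X$ is bounded if it has an element $1$ with $a\le 1$ for all $a\in X$, and commutative if $a\wedge b=b\wedge a$ for all $a,b\in X$. For a bounded commutative BCK-algebra $X$, an $X$-module is an abelian group $(M,+)$ with a map $X\times M\to M$, $(a,m)\mapsto am$, such that $(a\wedge b)m=a(bm)$, $a(m_1+m_2)=am_1+am_2$, $0m=0$ and $1m=m$ for all $a,b\in X$, $m,m_1,m_2\in M$. A submodule is a subgroup $N$ of $M$ that is an $X$-module under the same action. An $X$-homomorphism $f:M\to M'$ is a map with $f(m_1+m_2)=f(m_1)+f(m_2)$ and $f(xm)=xf(m)$ for all $x\in X$, $m,m_1,m_2\in M$. A decreasing sequence of submodules of $M$ is a family $(M_n)_{n\in\mathbb{Z}^+}$ of submodules with $M_{n+1}\subseteq M_n$ for all $n$. The Baig topology on $M$ admitted by it is $\{V\subseteq M : \forall v\in V\ \exists n\in\mathbb{Z}^+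 \text{ such that } v+M_n\subseteq V\}$. An $X$-homomorphism $f:M\to M'$ is strict (with respect to the two sequences) if $f(M_n)=f(M)\cap M'_n$ for all $n\in\mathbb{Z}^+$.
   Formalization: ''Open mapping'' is taken to mean open onto the image f(M) with the topology induced from M'; openness in M' itself can fail (f = 0 from M = 0 to M' = Z with all M'_n = Z), and the two senses agree exactly when f(M) is open in M'. *)

(* Defs.v *)
From HB Require Import structures.
From mathcomp Require Import all_boot all_order all_algebra.
From mathcomp Require Import all_classical topology.

Set Implicit Arguments.
Unset Strict Implicit.
Unset Printing Implicit Defensive.

Import GRing.Theory.
Local Open Scope classical_set_scope.
Local Open Scope ring_scope.

HB.mixin Record isBCK X := {
  bck0 : X;
  bck_op : X -> X -> X;
  bck_triangle : forall a b c,
    bck_op (bck_op (bck_op a b) (bck_op a c)) (bck_op c b) = bck0;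
  bck_opK : forall a b, bck_op (bck_op a (bck_op a b)) b = bck0;
  bck_opxx : forall a, bck_op a a = bck0;
  bck_op0x : forall a, bck_op bck0 a = bck0;
  bck_op_anti : forall a b, bck_op a b = bck0 -> bck_op b a = bck0 -> a = b
}.

#[short(type="bckType")]
HB.structure Definition BCK := {X of isBCK X}.

Definition bck_le (X : bckType) (a b : X) : Prop := bck_op a b = bck0.

Definition bck_meet (X : bckType) (a b : X) : X := bck_op b (bck_op b a).

HB.mixin Record isBoundedCommBCK X of BCK X := {
  bck1 : X;
  bck_le1 : forall a : X, bck_le a bck1;
  bck_meetC : forall a b : X, bck_meet a b = bck_meet b a
}.

#[short(type="bcBCKType")]
HB.structure Definition BoundedCommBCK := {X of isBoundedCommBCK X & BCK X}.

HB.mixin Record isBCKModule (X : bcBCKType) M of GRing.Zmodule M := {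
  act : X -> M -> M;
  act_meet : forall (a b : X) (m : M), act (bck_meet a b) m = act a (act b m);
  actDr : forall (a : X) (m1 m2 : M), act a (m1 + m2) = act a m1 + act a m2;
  act0 : forall m : M, act bck0 m = 0;
  act1 : forall m : M, act bck1 m = m
}.

#[short(type="bckModType")]
HB.structure Definition BCKModule (X : bcBCKType) :=
  {M of isBCKModule X M & GRing.Zmodule M}.

(* The module axioms are equations between elements of [M], so a subgroup is
   an [X]-module under the same action as soon as it is stable under it. *)
Record is_submodule (X : bcBCKType) (M : bckModType X) (N : set M) : Prop := {
  submodule0 : N 0;
  submoduleB : forall m1 m2, N m1 -> N m2 -> N (m1 - m2);
  submodule_act : forall (a : X) m, N m -> N (act a m)
}.

(* Sequences are indexed by the positive integers: [filt F n] is the term of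
   index [n.+1]. *)
Record filtration (X : bcBCKType) (M : bckModType X) := Filtration {
  filt :> nat -> set M;
  filt_submodule : forall n, is_submodule (filt n);
  filt_decr : forall n, filt n.+1 `<=` filt n
}.

Definition xhom (X : bcBCKType) (M M' : bckModType X) (f : M -> M') : Prop :=
  (forall m1 m2, f (m1 + m2) = f m1 + f m2) /\
  (forall (a : X) m, f (act a m) = act a (f m)).

Definition strict (X : bcBCKType) (M M' : bckModType X)
    (F : filtration M) (F' : filtration M') (f : M -> M') : Prop :=
  forall n, f @` F n = range f `&` F' n.

(* The underlying set of [M], carrying the Baig topology admitted by [F]. *)
Definition baig (X : bcBCKType) (M : bckModType X) (F : filtration M) : Type :=
  M.

Definition baig_open (X : bcBCKType) (M : bckModType X) (F : filtration M)
    (V : set M) : Prop :=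
  forall v, V v -> exists n, [set v + m | m in F n] `<=` V.

Section BaigTopology.
Context (X : bcBCKType) (M : bckModType X) (F : filtration M).

Lemma filt_le n k : (n <= k)%N -> F k `<=` F n.
Proof.
move=> /subnK <-; elim: (k - n)%N => [|d IH] //.
by apply: subset_trans IH; rewrite addSn; exact: filt_decr.
Qed.

Lemma baig_openT : baig_open F setT.
Proof. by move=> v _; exists 0%N. Qed.

Lemma baig_openI : setI_closed (baig_open F).
Proof.
move=> A B oA oB v [/oA[n nA] /oB[k kB]]; exists (maxn n k).
move=> _ [m Fm <-]; split.
  by apply: nA; exists m => //; exact: (filt_le (leq_maxl n k)).
by apply: kB; exists m => //; exact: (filt_le (leq_maxr n k)).
Qed.

Lemma baig_open_bigU (I : Type) (A : I -> set M) :
  (forall i, baig_open F (A i)) -> baig_open F (\bigcup_i A i).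
Proof.
move=> oA v [i _ /oA[n nA]]; exists n.
by move=> w /nA Aw; exists i.
Qed.

HB.instance Definition _ := Choice.copy (baig F) M.
HB.instance Definition _ :=
  isOpenTopological.Build (baig F) baig_openT baig_openI baig_open_bigU.

Lemma open_baigE (V : set (baig F)) : open V = baig_open F V.
Proof. by []. Qed.

End BaigTopology.

(* Open onto the image: direct images of open sets are open in [range f] for
   the topology induced by the codomain.  Strict homomorphisms need not be open
   in the other common sense, where the direct images must be open in the
   codomain: the zero map from 0 to a nonzero group [M'], with the constant
   sequences of terms 0 and [M'], is strict, but its image {0} is not open in
   [M'].  The two senses agree when [range f] is open, e.g. for surjections. *)
Definition open_mapping (T U : topologicalType) (f : T -> U) : Prop :=
  forall V : set T, open V -> open (f @` V : set (subspace (range f))).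

(* Main.v *)
Require Import Defs.
From HB Require Import structures.
From mathcomp Require Import all_boot all_order all_algebra.
From mathcomp Require Import all_classical topology.

(** Strictness says that, inside the image of [f], the neighbourhood [F' n] of
    0 is exactly [f @` F n]; by translation, if [v + F n] lies in [V], then the
    points of [range f] lying in the coset [f v + F' n] are images of points of
    [v + F n], hence belong to [f @` V].  Cosets of the terms of a filtration
    are open ([baig_open_coset]), so the union of all these cosets
    [f v + F' n] is an open set of the codomain whose trace on [range f] is
    [f @` V]. *)

Import GRing.Theory.
Local Open Scope classical_set_scope.
Local Open Scope ring_scope.

Lemma submoduleD (X : bcBCKType) (M : bckModType X) (N : set M) :
  is_submodule N -> forall m1 m2, N m1 -> N m2 -> N (m1 + m2).
Proof.
move=> subN m1 m2 Nm1 Nm2; rewrite -[m2]opprK.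
apply: (submoduleB subN) => //; rewrite -sub0r.
by apply: (submoduleB subN) => //; exact: (submodule0 subN).
Qed.

Lemma xhomB (X : bcBCKType) (M M' : bckModType X) (f : M -> M') :
  xhom f -> {morph f : m1 m2 / m1 - m2}.
Proof.
by move=> [fD _] m1 m2; apply: (addIr (f m2)); rewrite -fD !subrK.
Qed.

(** The coset [v + F n] is written as a condition on [w - v], the form in which
    strictness can be applied to [f x - f v].  Each of its points [w] has the
    neighbourhood [w + F n], which stays in it because [F n] is closed under
    addition. *)
Lemma baig_open_coset (X : bcBCKType) (M : bckModType X) (F : filtration M)
    (v : M) (n : nat) :
  open ([set w | F n (w - v)] : set (baig F)).
Proof.
rewrite open_baigE => w /= Fwv; exists n => _ [m Fm <-] /=.
by rewrite addrAC; apply: submoduleD => //; exact: filt_submodule.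
Qed.

Theorem proposition3p4 (X : bcBCKType) (M M' : bckModType X)
    (F : filtration M) (F' : filtration M') (f : M -> M') :
  xhom f -> strict F F' f ->
  open_mapping (f : baig F -> baig F').
Proof.
move=> fhom fstrict V oV; apply/open_subspaceP.
pose inside := [set p : M * nat | [set p.1 + m | m in F p.2] `<=` V].
pose W : set (baig F') := \bigcup_(p in inside) [set w | F' p.2 (w - f p.1)].
exists W; first by apply: bigcup_open => p _; exact: baig_open_coset.
apply/seteqP; split=> y [].
  move=> [[v n] /= vFV F'yv] [x _ fxy]; split; last by exists x.
  (* [f x - f v] is in the image and in [F' n], so it is some [f m] with
     [m] in [F n], even though [x - v] itself need not be in [F n]. *)
  have [m Fm fm] : (f @` F n) (f x - f v).
    rewrite fstrict; split; last by rewrite fxy.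
    by exists (x - v) => //; rewrite xhomB.
  exists (v + m); first by apply: vFV; exists m.
  by rewrite (proj1 fhom) fm addrC subrK.
move=> [v Vv fvy] ry; split=> //.
have [n vFV] : exists n, [set v + m | m in F n] `<=` V by exact: oV.
exists (v, n) => //=; rewrite -fvy subrr.
exact: submodule0 (filt_submodule _ _).
Qed.
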